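(* Let $n\ge 3$ and let $A_n,B_n$ be two distinct fixed points in the plane. For a point $A_1$ such that $A_nA_1B_n$ is a (non-degenerate) triangle, construct the regular $n$-gons $A_1A_2\cdots A_n$ and $A_1B_2\cdots B_n$ on the sides $A_1A_n$ and $A_1B_n$, with opposite orientations (the orientation of each of the two polygons being the same for all positions of $A_1$). Let $D_1$ and $D_2$ be the points on the circumcircles of $A_1A_2\cdots A_n$ and $A_1B_2\cdots B_n$, respectively, that are diametrically opposite to the common vertex $A_1$. Then the midpoint of the line segment $D_1D_2$ is independent of the location of $A_1$.
   Context: Vertices of polygons are listed in cyclic order, so $A_1A_n$ is a side of $A_1A_2\cdots A_n$ and $A_1B_n$ is a side of $A_1B_2\cdots B_n$. The orientation of a polygon $P_1P_2\cdots P_n$ is the sense (clockwise or anticlockwise) in which its vertices are traversed in the listed order; two polygons have opposite orientations if one is listed clockwise and the other anticlockwise. *)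

(* Defs.v *)
From HB Require Import structures.
From mathcomp Require Import all_boot all_order all_algebra.
From mathcomp Require Import reals trigo.
Set Implicit Arguments.
Unset Strict Implicit.
Unset Printing Implicit Defensive.
Import Order.TTheory GRing.Theory Num.Theory.
Local Open Scope ring_scope.

Section Plane.
Variable R : realType.

(* The norm that MathComp-Analysis puts on matrices is the sup norm, so the
   Euclidean structure of the plane is given by hand. *)
Definition point : Type := 'rV[R]_2.

Definition dot (u v : point) : R := (u *m v^T) 0 0.

Definition cross (u v : point) : R := u 0 0 * v 0 1 - u 0 1 * v 0 0.

Definition enorm (u : point) : R := Num.sqrt (dot u u).

Definition edist (X Y : point) : R := enorm (Y - X).

Definition midpoint (X Y : point) : point := 2^-1 *: (X + Y).

(* Unoriented angle XYZ, in [0, pi]. *)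
Definition angle (X Y Z : point) : R :=
  acos (dot (X - Y) (Z - Y) / (enorm (X - Y) * enorm (Z - Y))).

(* Twice the signed area of XYZ: positive iff Z is strictly to the left of the
   directed line XY. *)
Definition orient (X Y Z : point) : R := cross (Y - X) (Z - X).

Definition nondegenerate_triangle (X Y Z : point) : Prop := orient X Y Z != 0.

Definition on_circle (O : point) (r : R) (X : point) : Prop := edist O X = r.

Definition diametrically_opposite (O : point) (r : R) (X Y : point) : Prop :=
  [/\ on_circle O r X, on_circle O r Y & midpoint X Y = O].

Section Polygon.
Variable n : nat.

(* The vertex P_(i+1) of P_1 ... P_n is [tnth P i]; [ordS] and [ord_pred] are
   the cyclic successor and predecessor on 'I_n. *)
Implicit Type P : n.-tuple point.

(* For every side, all the other vertices lie strictly on the same side of the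
   line through it; this excludes star polygons and repeated vertices. *)
Definition convex_polygon P : Prop :=
  forall i j k : 'I_n,
    j != i -> j != ordS i -> k != i -> k != ordS i ->
    0 < orient (tnth P i) (tnth P (ordS i)) (tnth P j)
        * orient (tnth P i) (tnth P (ordS i)) (tnth P k).

Definition equilateral P : Prop :=
  forall i j : 'I_n,
    edist (tnth P i) (tnth P (ordS i)) = edist (tnth P j) (tnth P (ordS j)).

Definition vertex_angle P (i : 'I_n) : R :=
  angle (tnth P (ord_pred i)) (tnth P i) (tnth P (ordS i)).

Definition equiangular P : Prop :=
  forall i j : 'I_n, vertex_angle P i = vertex_angle P j.

Definition regular_polygon P : Prop :=
  [/\ convex_polygon P, equilateral P & equiangular P].

(* Shoelace formula. *)
Definition signed_area P : R :=
  2^-1 * \sum_(i < n) cross (tnth P i) (tnth P (ordS i)).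

(* [has_orientation true P]: P is listed anticlockwise;
   [has_orientation false P]: P is listed clockwise. *)
Definition has_orientation (anticlockwise : bool) P : Prop :=
  if anticlockwise then 0 < signed_area P else signed_area P < 0.

Definition circumcircle P (O : point) (r : R) : Prop :=
  forall i : 'I_n, on_circle O r (tnth P i).

End Polygon.
End Plane.

(* Main.v *)
Require Import Defs.
From HB Require Import structures.
From mathcomp Require Import all_boot all_order all_algebra.
From mathcomp Require Import reals trigo.
From mathcomp Require Import boolp complex ring lra.
Set Implicit Arguments.
Unset Strict Implicit.
Unset Printing Implicit Defensive.
Import Order.TTheory GRing.Theory Num.Theory.
Local Open Scope ring_scope.

(** Identify the plane with the complex numbers and translate the circumcentre
    of a regular n-gon to 0. Equal sides of an inscribed polygon, together with
    P_(k+2) <> P_k, force its vertices to be w^k z for a fixed w on the unit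
    circle, and convexity says that w is a primitive n-th root of unity such that
    every root other than 1 and w lies strictly on one side of the chord (1, w).
    This determines w up to conjugation, and the orientation of the polygon is the
    sign of Im w; so the two polygons have conjugate ratios w and w^*. As
    D1 - A1 = -2z and An - A1 = (w^-1 - 1) z, we get
    D1 = A1 + 2 (An - A1) / (1 - w^* ) and D2 = A1 + 2 (Bn - A1) / (1 - w),
    and A1 cancels in D1 + D2 because 1 / (1 - w) + 1 / (1 - w^* ) = 1. *)

(** * Unit circle and roots of unity in the complex plane *)

Section ComplexPlane.
Variable R : rcfType.
Implicit Types (x y z w : R[i]) (n : nat).
Local Open Scope complex_scope.
Local Notation Re := (@complex.Re R).
Local Notation Im := (@complex.Im R).

Definition sqnorm x : R := Re x ^+ 2 + Im x ^+ 2.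

Definition crossc x y : R := Re x * Im y - Im x * Re y.

Lemma complexP x y : Re x = Re y -> Im x = Im y -> x = y.
Proof. by case: x y => [a b] [c d] /= -> ->. Qed.

Lemma Im_conjc x : Im (conjc x) = - Im x.
Proof. by case: x. Qed.

Lemma subr1_neq0 x : Im x != 0 -> 1 - x != 0.
Proof. by apply: contraNneq => /subr0_eq <-. Qed.

Lemma sqnormM x y : sqnorm (x * y) = sqnorm x * sqnorm y.
Proof. by case: x y => [a b] [c d]; rewrite /sqnorm /=; ring. Qed.

Lemma sqnorm_eq0 x : (sqnorm x == 0) = (x == 0).
Proof. by rewrite /sqnorm paddr_eq0 ?sqr_ge0 // !sqrf_eq0 eq_complex. Qed.

Lemma crosscMl x y z : crossc (z * x) (z * y) = sqnorm z * crossc x y.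
Proof.
by case: x y z => [a b] [c d] [e f]; rewrite /crossc /sqnorm /=; ring.
Qed.

Lemma mulCJ x : x * conjc x = (sqnorm x)%:C.
Proof.
by case: x => a b; apply: complexP; rewrite /sqnorm /=; ring.
Qed.

Lemma unit_circle_conjV w : sqnorm w = 1 -> conjc w = w^-1.
Proof.
move=> w1; have w0 : w != 0 by rewrite -sqnorm_eq0 w1 oner_eq0.
by apply: (mulfI w0); rewrite mulCJ w1 divff.
Qed.

(** On the unit circle [sqnorm (x - 1)] is [2 - 2 Re x], so the chord fixes the real part, and the
    imaginary part up to sign. *)
Lemma unit_circle_chord x y : sqnorm x = 1 -> sqnorm y = 1 ->
  sqnorm (x - 1) = sqnorm (y - 1) -> x = y \/ x = conjc y.
Proof.
case: x y => [a b] [c d]; rewrite /sqnorm /= => x1 y1 xy.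
have ac : a = c by lra.
have /eqP : b ^+ 2 = d ^+ 2 by rewrite ac in x1; lra.
by rewrite ac eqf_sqr => /orP[] /eqP ->; [left | right].
Qed.

(** Successive quotients lie on the unit circle at a constant distance from 1, so neighbouring ones
    are equal or conjugate; conjugate ones have product 1 and would give [Z k.+2 = Z k]. *)
Lemma equal_chords_geometric (Z : nat -> R[i]) (rho s : R) : rho != 0 ->
  (forall k, sqnorm (Z k) = rho) ->
  (forall k, sqnorm (Z k.+1 - Z k) = s) ->
  (forall k, Z k.+2 != Z k) ->
  exists2 w, sqnorm w = 1 & forall k, Z k = w ^+ k * Z 0%N.
Proof.
move=> rho0 Zrho Zs Z2.
have Z0 k : Z k != 0 by rewrite -sqnorm_eq0 Zrho.
pose q k := Z k.+1 / Z k.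
have qZ k : Z k.+1 = q k * Z k by rewrite divfK.
have q1 k : sqnorm (q k) = 1.
  by apply: (mulIf rho0); rewrite mul1r -{1}(Zrho k) -sqnormM -qZ.
have qs k : sqnorm (q k - 1) * rho = s.
  by rewrite -(Zrho k) -sqnormM mulrBl mul1r -qZ.
have qS k : q k.+1 = q k.
  have [|//|qJ] := unit_circle_chord (q1 k.+1) (q1 k).
    by apply: (mulIf rho0); rewrite !qs.
  by case/eqP: (Z2 k); rewrite !qZ qJ mulrA [conjc _ * _]mulrC mulCJ q1 mul1r.
have qE k : q k = q 0%N by elim: k => [//|k IH]; rewrite qS.
exists (q 0%N) => //; elim=> [|k IH]; first by rewrite mul1r.
by rewrite qZ qE {1}IH mulrA exprS.
Qed.

(** For [n >= 3] these are the two roots of unity adjacent to 1. The factor [Im w] makes the side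
    condition invariant under conjugation. *)
Definition convex_root n w : Prop :=
  [/\ n.-primitive_root w, sqnorm w = 1 &
      forall j, (1 < j < n)%N -> 0 < Im w * crossc (w - 1) (w ^+ j - 1)].

(** Otherwise [w'] and its conjugate would both be powers of [w] beyond the chord from 1 to [w], and
    symmetrically with the roles exchanged. *)
Lemma convex_root_conj n w w' : (1 < n)%N ->
  convex_root n w -> convex_root n w' -> w' = w \/ w' = conjc w.
Proof.
have key v v' m : (1 < m)%N -> convex_root m v -> convex_root m v' ->
    v' = v \/ v' = conjc v \/
    0 < Im v * crossc (v - 1) (v' - 1) /\ 0 < Im v * crossc (v - 1) (conjc v' - 1).
  move=> m1 [pv v1 Hv] [pv' _ _].
  have [[j jm] /= jE] := prim_rootP pv (prim_expr_order pv').
  have vV := unit_circle_conjV v1.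
  have v0 : v != 0 by rewrite -sqnorm_eq0 v1 oner_eq0.
  have vmB k : (k <= m)%N -> conjc (v ^+ k) = v ^+ (m - k).
    move=> km; rewrite rmorphXn /= vV exprVn; apply: (mulfI (expf_neq0 k v0)).
    by rewrite divff ?expf_neq0 // -exprD subnKC // prim_expr_order.
  case: j jm jE => [|[|j]] jm jE.
  - move: (prim_order_dvd pv' 1); rewrite jE !expr1 expr0 eqxx dvdn1.
    by move=> /eqP mE; rewrite mE in m1.
  - by left.
  (* The conjugate of [v'] is [v ^+ (m - j.+2)]; when this exponent is 1, [v'] is [conjc v]. *)
  case: (ltnP 1 (m - j.+2)%N) => jm2; last first.
    right; left; have mE : m = j.+3.
      by apply/eqP; rewrite eqn_leq jm andbT -addn1 -leq_subLR.
    by rewrite jE vV; apply: (mulfI v0); rewrite -exprS -mE divff // prim_expr_order.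
  right; right; rewrite jE vmB 1?ltnW //; split; apply: Hv; rewrite /= ?jm //.
  by rewrite jm2 ltn_subrL (ltnW m1).
move=> n1 cw cw'.
have [->|[->|[w1 w2]]] := key _ _ _ n1 cw cw'; [by left | by right |].
have [->|[->|[w3 w4]]] := key _ _ _ n1 cw' cw;
  [by left | by rewrite conjcK; right |].
(* With w = c + i d and w' = a + i b, the four inequalities say
   d^2 (1 - a) > (1 - c) |d b| and b^2 (1 - c) > (1 - a) |d b|: the two chords
   cannot each be closer to 1 than the other. *)
exfalso; move: w1 w2 w3 w4; case: w {cw} => c d; case: w' {cw'} => a b.
rewrite /crossc /= => w1 w2 w3 w4.
have [ac|ac] := lerP (d ^+ 2 * (1 - a)) (b ^+ 2 * (1 - c)).
all: nra.
Qed.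

End ComplexPlane.

(** * Regular polygons as orbits of a rotation *)

Section RegularPolygons.
Variable R : realType.
Implicit Types (X Y u v : point R).
Local Notation Re := (@complex.Re R).
Local Notation Im := (@complex.Im R).

Definition affix u : R[i] := Complex (u 0 0) (u 0 1).

Definition of_affix (x : R[i]) : point R := \row_j if j == 0 then Re x else Im x.

Lemma affixK : cancel affix of_affix.
Proof.
move=> u; apply/rowP => j; rewrite mxE.
by case: eqP => [->//|/eqP j0]; congr (u _ _); apply/val_inj; case: j j0 => [[|[|]]].
Qed.

Lemma of_affixK : cancel of_affix affix.
Proof. by case=> a b; rewrite /affix !mxE. Qed.

Lemma affixD u v : affix (u + v) = affix u + affix v.
Proof. by apply: complexP; rewrite /= !mxE. Qed.

Lemma affixB u v : affix (u - v) = affix u - affix v.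
Proof. by apply: complexP; rewrite /= !mxE. Qed.

Lemma crossE u v : cross u v = crossc (affix u) (affix v).
Proof. by []. Qed.

Lemma dotE u : dot u u = sqnorm (affix u).
Proof.
rewrite /dot mxE big_ord_recl big_ord1 !mxE.
by have -> : lift ord0 ord0 = 1 :> 'I_2 by apply: val_inj.
Qed.

Lemma edistE X Y r : edist X Y = r -> sqnorm (affix Y - affix X) = r ^+ 2.
Proof.
move=> <-; rewrite /edist /enorm dotE affixB sqr_sqrtr //.
by rewrite addr_ge0 ?sqr_ge0.
Qed.

Lemma orientE X Y Z : orient X Y Z = crossc (affix Y - affix X) (affix Z - affix X).
Proof. by rewrite /orient crossE !affixB. Qed.

Lemma affix_midpoint X Y : affix (midpoint X Y) = (affix X + affix Y) / 2.
Proof.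
have halves : 2^-1 + 2^-1 = 1 :> R by lra.
have -> : affix X + affix Y = affix (midpoint X Y) * 2.
  by rewrite -affixD mulr_natr mulr2n -affixD -scalerDl halves scale1r.
by rewrite mulfK ?pnatr_eq0.
Qed.

(** The area is that of [n] congruent triangles with apex at the circumcentre, so its sign is that
    of [Im w]. *)
Lemma regular_polygon_geometric n (P : n.-tuple (point R)) O r : (2 < n)%N ->
  regular_polygon P -> circumcircle P O r ->
  exists2 w : R[i], convex_root n w &
    exists z, [/\ forall i : 'I_n, affix (tnth P i) = affix O + w ^+ i * z,
        z != 0 &
      signed_area P = 2^-1 * (n%:R * (sqnorm z * Im w))].
Proof.
move=> n2 [convP eqlP _] circP.
have n0 : (0 < n)%N by apply: leq_trans n2.
(* Reading indices modulo [n] turns the vertices into a periodic sequence over [nat]. *)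
pose ordm k : 'I_n := Ordinal (ltn_pmod k n0).
have ordmS k : ordS (ordm k) = ordm k.+1.
  by apply: val_inj; rewrite /= -[(k %% n).+1]addn1 modnDml addn1.
have ordmE (i : 'I_n) : ordm i = i by apply: val_inj; rewrite /= modn_small.
pose Z k := affix (tnth P (ordm k)) - affix O.
have PZ k : affix (tnth P (ordm k)) = affix O + Z k by rewrite addrC subrK.
have Zr k : sqnorm (Z k) = r ^+ 2 by exact: edistE (circP _).
have Zs k : sqnorm (Z k.+1 - Z k) =
    edist (tnth P (ordm 0)) (tnth P (ordm 1)) ^+ 2.
  have -> : Z k.+1 - Z k = affix (tnth P (ordm k.+1)) - affix (tnth P (ordm k)).
    by rewrite !PZ; ring.
  apply: edistE.
  rewrite -ordmS; have -> := eqlP (ordm k) (ordm 0%N).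
  by rewrite ordmS.
have ordm_neq k l : (0 < l < n)%N -> ordm (k + l) != ordm k.
  case/andP=> l0 ln; rewrite -val_eqE /= -[X in _ == X %[mod _]]addn0 eqn_modDl.
  by rewrite mod0n modn_small // -lt0n.
have conv j k : (1 < j < n)%N -> (1 < k < n)%N ->
    0 < crossc (Z 1%N - Z 0%N) (Z j - Z 0%N)
        * crossc (Z 1%N - Z 0%N) (Z k - Z 0%N).
  have neq l : (1 < l < n)%N -> ordm l != ordm 0 /\ ordm l != ordS (ordm 0).
    move=> /andP[l1 ln]; rewrite ordmS; split.
      by rewrite -[l]add0n ordm_neq // ln (ltnW l1).
    have -> : l = (1 + l.-1)%N by rewrite add1n prednK // ltnW.
    by apply: ordm_neq; case: l l1 ln => [|[|l]] //= _ /ltnW.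
  move=> /neq[j0 j1] /neq[k0 k1]; have := convP _ _ _ j0 j1 k0 k1.
  have PZB l : affix (tnth P (ordm l)) - affix (tnth P (ordm 0%N)) = Z l - Z 0%N.
    by rewrite !PZ; ring.
  by rewrite !orientE ordmS !PZB.
(* A vertex equal to the one two places before would lie on the line of a side through that one,
   against strict convexity. *)
have Z2 k : Z k.+2 != Z k.
  have d1 : ordm k.+2 != ordm k by rewrite -addn2 ordm_neq.
  have d2 : ordm k.+2 != ordS (ordm k).
    by rewrite ordmS -[k.+2]addn1 ordm_neq //= ltnW.
  have := convP _ _ _ d1 d2 d1 d2; apply: contraTneq => ZZ.
  by rewrite !orientE !PZ ZZ subrr /crossc /= !mulr0 subrr mulr0 ltxx.
have z0 : Z 0%N != 0.
  apply: contraNneq (Z2 0%N) => z0.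
  by rewrite z0 -sqnorm_eq0 Zr -(Zr 0%N) z0 sqnorm_eq0.
have r0 : r ^+ 2 != 0 by rewrite -(Zr 0%N) sqnorm_eq0.
have [w w1 ZE] := equal_chords_geometric r0 Zr Zs Z2.
pose g j := crossc (w - 1) (w ^+ j - 1).
have gE j k : (1 < j < n)%N -> (1 < k < n)%N -> 0 < g j * g k.
  have ZB l : Z l - Z 0%N = Z 0%N * (w ^+ l - 1).
    by rewrite (ZE l); ring.
  move=> jn kn; have := conv j k jn kn.
  rewrite !ZB !crosscMl mulrACA expr1 pmulr_rgt0 //.
  by rewrite -expr2 exprn_even_gt0 //= sqnorm_eq0.
have wn : w ^+ n = 1.
  apply: (mulIf z0); rewrite -ZE mul1r /Z; congr (affix (tnth P _) - _).
  by apply: val_inj; rewrite /= modnn mod0n.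
(* The exponent [n.-1] gives [conjc w], for which [g] is [2 (1 - Re w) Im w]; hence every [g j] has
   the sign of [Im w]. *)
have nn : (1 < n.-1 < n)%N by case: (n) n2 => [|[|[|m]]] //=.
have w0 : w != 0 by rewrite -sqnorm_eq0 w1 oner_eq0.
have wV : w ^+ n.-1 = conjc w.
  rewrite unit_circle_conjV //; apply: (mulfI w0).
  by rewrite -exprS prednK // divff.
have gn : g n.-1 = 2 * (1 - Re w) * Im w.
  by rewrite /g wV; case: (w) => a b; rewrite /crossc /=; ring.
have c1 : 0 < 1 - Re w.
  have wn1 : Re w != 1.
    apply/eqP=> c1; have := gE _ _ nn nn.
    by rewrite gn c1 subrr mulr0 mul0r mul0r ltxx.
  have : Re w ^+ 2 <= 1 by rewrite -w1 lerDl sqr_ge0.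
  by rewrite subr_gt0 lt_neqAle wn1 => w2; nra.
have dg j : (1 < j < n)%N -> 0 < Im w * g j.
  have c2 : 0 < 2 * (1 - Re w) by lra.
  by move=> jn; have := gE _ _ nn jn; rewrite gn -[_ * g j]mulrA (pmulr_rgt0 _ c2).
have g0 j : (1 < j < n)%N -> w ^+ j != 1.
  move=> jn; apply/eqP => wj; have := dg j jn.
  by rewrite /g wj subrr /crossc /= !mulr0 subrr mulr0 ltxx.
have prim_w : n.-primitive_root w.
  apply/andP; split=> //; apply/forallP => -[i /= i_n]; rewrite unity_rootE.
  apply/eqP; case: (eqVneq i.+1 n) => [->|i1]; first by rewrite wn eqxx.
  have {}i_n : (i.+1 < n)%N by rewrite ltn_neqAle i1.
  apply/negbTE; case: i {i1} i_n => [|i] i_n; last exact: g0.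
  by rewrite expr1; apply/eqP => wE; move: c1; rewrite wE subrr ltxx.
exists w => //; exists (Z 0%N); split=> //.
  by move=> i; rewrite -ZE -PZ ordmE.
rewrite /signed_area; congr (_ * _).
(* The contribution of the centre to the shoelace sum telescopes to [f n - f 0], which vanishes
   because [w ^+ n = 1]. *)
pose f k := crossc (affix O) (Z k).
have step (i : 'I_n) : cross (tnth P i) (tnth P (ordS i)) =
    (f i.+1 - f i) + sqnorm (Z 0%N) * Im w.
  rewrite crossE -{1 2}(ordmE i) ordmS !PZ /f.
  have -> : Z i.+1 = w * Z i by rewrite (ZE i.+1) (ZE i) exprS mulrA.
  have -> : sqnorm (Z 0%N) = sqnorm (Z i) by rewrite !Zr.
  rewrite /crossc /sqnorm.
  by case: (Z i) (w) (affix O) => [a b] [c d] [e h] /=; ring.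
rewrite (eq_bigr _ (fun i _ => step i)) big_split /= sumr_const card_ord.
rewrite -(big_mkord xpredT (fun i => f i.+1 - f i)) telescope_sumr //.
by rewrite /f (ZE n) wn mul1r subrr add0r mulr_natl.
Qed.

Lemma regular_polygon_antipode n (P : n.-tuple (point R)) o O r X Y D :
  (2 < n)%N -> regular_polygon P -> P`_0 = X -> P`_n.-1 = Y ->
  has_orientation o P -> circumcircle P O r -> diametrically_opposite O r X D ->
  exists w : R[i], [/\ convex_root n w, if o then 0 < Im w else Im w < 0 &
    affix D = affix X + 2 * (affix Y - affix X) / (1 - conjc w)].
Proof.
move=> n2 regP P0 Pn oP circP [_ _ XD].
have n0 : (0 < n)%N by apply: leq_trans n2.
have [w cw [z [PE z0 areaP]]] := regular_polygon_geometric n2 regP circP.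
have [pw w1 _] := cw.
have sw : if o then 0 < Im w else Im w < 0.
  have c0 : 0 < 2^-1 * (n%:R * sqnorm z).
    rewrite !mulr_gt0 ?invr_gt0 ?ltr0n // lt_neqAle eq_sym sqnorm_eq0 z0.
    by rewrite addr_ge0 ?sqr_ge0.
  by move: oP; rewrite /has_orientation areaP !mulrA -[_ * n%:R * _]mulrA;
    case: (o); rewrite ?(pmulr_rgt0 _ c0) ?(pmulr_rlt0 _ c0).
exists w; split=> //.
have n1n : (n.-1 < n)%N by rewrite prednK.
have XE : affix X = affix O + z.
  by rewrite -P0 -(tnth_nth 0 P (Ordinal n0)) PE mul1r.
have w0 : w != 0 by rewrite -sqnorm_eq0 w1 oner_eq0.
have YE : affix Y = affix O + conjc w * z.
  rewrite -Pn -(tnth_nth 0 P (Ordinal n1n)) PE /= unit_circle_conjV //.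
  congr (_ + _ * _); apply: (mulfI w0).
  by rewrite -exprS prednK // divff // prim_expr_order.
have DE : affix D = 2 * affix O - affix X.
  by rewrite -XD affix_midpoint mulrC divfK ?pnatr_eq0 // addrAC subrr add0r.
have w'1 : 1 - conjc w != 0.
  apply: subr1_neq0; rewrite Im_conjc oppr_eq0.
  by case: (o) sw => [/gt_eqF|/lt_eqF] ->.
by rewrite DE XE YE; field.
Qed.

End RegularPolygons.

(** * The fixed midpoint *)

Theorem theorem8p1 (R : realType) (n : nat) (hn : (3 <= n)%N)
    (An Bn : point R) (hAB : An <> Bn) (o : bool) :
  exists M : point R,
    forall (A1 : point R) (A B : n.-tuple (point R))
           (O1 O2 : point R) (r1 r2 : R) (D1 D2 : point R),
      nondegenerate_triangle An A1 Bn ->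
      regular_polygon A -> A`_0 = A1 -> A`_n.-1 = An ->
      regular_polygon B -> B`_0 = A1 -> B`_n.-1 = Bn ->
      has_orientation o A -> has_orientation (~~ o) B ->
      circumcircle A O1 r1 -> diametrically_opposite O1 r1 A1 D1 ->
      circumcircle B O2 r2 -> diametrically_opposite O2 r2 A1 D2 ->
      midpoint D1 D2 = M.
Proof.
have n1 : (1 < n)%N := ltnW hn.
(* The midpoint must be chosen before any polygon is given, so [w] comes from excluded middle;
   without such a root no polygon [A] exists and 0 serves as a dummy value. *)
have [[w [cw ow]]|no_w] := EM (exists w : R[i],
    convex_root n w /\ if o then 0 < complex.Im w else complex.Im w < 0);
  last first.
  exists 0 => A1 A B O1 O2 r1 r2 D1 D2 _ rA A0 An1 _ _ _ oA _ cA dA _ _.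
  have [w [cw ow _]] := regular_polygon_antipode hn rA A0 An1 oA cA dA.
  by case: no_w; exists w.
have [_ w1 _] := cw.
exists (of_affix (affix An / (1 - conjc w) + affix Bn / (1 - w))).
move=> A1 A B O1 O2 r1 r2 D1 D2 _ rA A0 An1 rB B0 Bn1 oA oB cA dA cB dB.
have [u [cu ou D1E]] := regular_polygon_antipode hn rA A0 An1 oA cA dA.
have [v [cv ov D2E]] := regular_polygon_antipode hn rB B0 Bn1 oB cB dB.
have w_neq1 : 1 - w != 0.
  by apply: subr1_neq0; case: (o) ow => [/gt_eqF|/lt_eqF] ->.
(* The prescribed orientations select [w] for [A] and its conjugate for [B]. *)
have uE : u = w.
  have [//|uJ] := convex_root_conj n1 cw cu; exfalso.
  by move: ow ou; rewrite uJ Im_conjc; case: (o); lra.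
have vE : v = conjc w.
  have [vw|//] := convex_root_conj n1 cw cv; exfalso.
  by move: ow ov; rewrite vw; case: (o) => /=; lra.
have w0 : w != 0 by rewrite -sqnorm_eq0 w1 oner_eq0.
apply: (can_inj (@affixK R)).
(* Replacing [conjc w] by [w^-1] leaves a rational identity in [w]. *)
rewrite of_affixK affix_midpoint D1E D2E uE vE conjcK unit_circle_conjV //.
by field; rewrite w_neq1 w0 -opprB oppr_eq0.
Qed.
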